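(* Let $k,n \in \mathbb{N}$ with $k \le n$, and let $f:[n]\to\{0,1\}$ be non-trivial. Then there is a constant $\epsilon\in(0,1)$ such that the randomized $\epsilon$-error communication complexity of the $k$-step pointer chasing problem $\mathrm{PC}^{f}_{n,k}$ is $\Omega(k\log(n/k))$.
   Context: Write $[n]=\{1,\dots,n\}$. Given $N_A,N_B\in[n]^n$ (functions $[n]\to[n]$), define for $r\ge 0$ and $i\in[n]$ the functions $\mathrm{Walk}_A^{r},\mathrm{Walk}_B^{r}$ by mutual recursion: $\mathrm{Walk}_A^{0}(i)=i$, $\mathrm{Walk}_A^{r}(i)=\mathrm{Walk}_B^{r-1}(N_A(i))$ for $r>0$; $\mathrm{Walk}_B^{0}(i)=i$, $\mathrm{Walk}_B^{r}(i)=\mathrm{Walk}_A^{r-1}(N_B(i))$ for $r>0$. In the $k$-step pointer chasing problem $\mathrm{PC}^{f}_{n,k}$, Alice is given $N_A$, Bob is given $N_B$, both know $f$, and the goal is to compute $f(\mathrm{Walk}_A^{k}(1))$. A function $f:[n]\to\{0,1\}$ is non-trivial if there exist $i,j\in[n]\setminus\{1\}$ with $f(i)\neq f(j)$. Protocols are two-party randomized public-coin protocols (shared random string) with no restriction on the number of rounds; a designated party outputs the answer. A protocol computes a function with error $\epsilon$ if on every input it outputs the correct value with probability at least $1-\epsilon$. Its expected communication cost is the maximum over inputs of the expected number of bits exchanged. The randomized $\epsilon$-error communication complexity is the minimum expected communication cost of a protocol computing the function with error $\epsilon$.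
   Formalization: The formal theorem assumes k ≥ 2: for k = 1 the value f(N_A(1)) is known to Alice and needs at most one bit, so the bound Ω(log n) fails, and for k = 0 the expression log(n/k) is undefined. *)

(* Defs.v *)
From HB Require Import structures.
From mathcomp Require Import all_boot all_order all_algebra.
From mathcomp Require Import all_classical all_reals all_analysis.

Set Implicit Arguments.
Unset Strict Implicit.
Unset Printing Implicit Defensive.

Import Order.TTheory GRing.Theory Num.Theory.
Local Open Scope ring_scope.
Local Open Scope classical_set_scope.

Inductive party := Alice | Bob.

Definition input (X Y : Type) (p : party) : Type :=
  match p with Alice => X | Bob => Y end.

Definition input_of (X Y : Type) (p : party) (x : X) (y : Y) : input X Y p :=
  match p with Alice => x | Bob => y end.

(* Deterministic protocols as binary trees.  At [Send p b t] party [p] sends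
   the bit [b] computed from its own input.  At a leaf the designated party [w]
   computes the answer from its own input; the transcript is known to it, since
   it determines the leaf. *)
Inductive dprotocol (X Y Z : Type) (w : party) : Type :=
| Output of (input X Y w -> Z)
| Send (p : party) of (input X Y p -> bool) & (bool -> dprotocol X Y Z w).

Fixpoint output (X Y Z : Type) (w : party) (t : dprotocol X Y Z w)
    (x : X) (y : Y) : Z :=
  match t with
  | Output g => g (input_of w x y)
  | Send p b next => output (next (b (input_of p x y))) x y
  end.

Fixpoint bits (X Y Z : Type) (w : party) (t : dprotocol X Y Z w)
    (x : X) (y : Y) : nat :=
  match t with
  | Output _ => 0%N
  | Send p b next => (bits (next (b (input_of p x y))) x y).+1
  end.

(* Public-coin protocols: the shared random string is a point of an arbitrary
   probability space and selects a deterministic protocol.  The number of bits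
   need not be bounded uniformly in the random string. *)
Record rprotocol (R : realType) (X Y Z : Type) := RProtocol {
  coin_display : measure_display;
  coin : measurableType coin_display;
  coin_law : probability coin R;
  designated : party;
  run : coin -> dprotocol X Y Z designated;
  measurable_output : forall (x : X) (y : Y) (z : Z),
    measurable [set r | output (run r) x y = z];
  measurable_bits : forall (x : X) (y : Y) (m : nat),
    measurable [set r | bits (run r) x y = m]
}.

Definition computes (R : realType) (X Y Z : Type) (pi : rprotocol R X Y Z)
    (eps : R) (g : X -> Y -> Z) : Prop :=
  forall (x : X) (y : Y),
    ((1 - eps)%:E
       <= coin_law pi [set r : coin pi | output (run r) x y = g x y])%E.

(* For finite [X] and [Y] the supremum is a maximum. *)
Definition expected_cost (R : realType) (X Y Z : Type)
    (pi : rprotocol R X Y Z) : \bar R :=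
  ereal_sup [set (\int[coin_law pi]_r ((bits (run r) xy.1 xy.2)%:R : R)%:E)%E
            | xy in [set: X * Y]].

(* An infimum, since no optimal protocol is known to exist a priori. *)
Definition rand_cc (R : realType) (X Y Z : Type) (eps : R) (g : X -> Y -> Z) :
    \bar R :=
  ereal_inf [set c : \bar R | exists pi : rprotocol R X Y Z,
               computes pi eps g /\ c = expected_cost pi].

Fixpoint walkA (T : Type) (NA NB : T -> T) (r : nat) (i : T) : T :=
  match r with 0%N => i | r'.+1 => walkB NA NB r' (NA i) end
with walkB (T : Type) (NA NB : T -> T) (r : nat) (i : T) : T :=
  match r with 0%N => i | r'.+1 => walkA NA NB r' (NB i) end.

(* ['I_n.+1] stands for [{1, ..., n + 1}], with [ord0] in the role of [1]. *)
Definition pointer_chasing (n k : nat) (f : 'I_n.+1 -> bool)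
    (NA NB : {ffun 'I_n.+1 -> 'I_n.+1}) : bool :=
  f (walkA NA NB k ord0).

Definition nontrivial (n : nat) (f : 'I_n.+1 -> bool) : Prop :=
  exists i j : 'I_n.+1, [/\ i <> ord0, j <> ord0 & f i <> f j].

(* Main.v *)
Require Import Defs.
From HB Require Import structures.
From mathcomp Require Import all_boot all_order all_algebra.
From mathcomp Require Import all_classical all_reals all_analysis.
From mathcomp Require Import perm measurable_realfun ring lra zify.

(* A walk that carries one bit through K layers computes the exclusive or of K
   index functions on m addresses, with O(K m) nodes and 2 K steps. The sign
   matrix of this function has orthogonal rows, so by Lindsey's lemma every
   rectangle has discrepancy at most m ^ (-K / 2) under the uniform
   distribution. A protocol truncated at depth D splits the inputs into at most
   2 ^ D rectangles, hence has correlation at most 2 ^ D m ^ (-K / 2) with the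
   function; as the error and, by Markov's inequality, the truncation cost
   little, the expected cost is at least of order K log m. Take K = k / 2 and m
   of order n / k when n >= 8 k, and K of order n and m = 4 otherwise; a bounded
   n is handled by embedding a conjunction of two bits. *)

Set Implicit Arguments.
Unset Strict Implicit.
Unset Printing Implicit Defensive.

Import Order.TTheory GRing.Theory Num.Theory.
Local Open Scope ring_scope.

(** * Rectangles and protocol trees *)

(* [ring] reads an exponent as a numeral, so the signs have to be abstracted. *)
Ltac sign_ring :=
  repeat match goal with |- context [@GRing.exp ?R ?x (nat_of_bool ?c)] =>
    generalize (@GRing.exp R x (nat_of_bool c)) end;
  move=> *; ring.

Section Rectangles.
Variables (R : realType) (X Y : finType) (g : X -> Y -> bool).

(** Orthogonality of two rows of the sign matrix: on the finite type [Y] the injection [phi] is a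
    bijection that exchanges the columns where the rows agree with those where they differ. *)
Definition decorrelated := forall x x' : X, x != x' ->
  exists2 phi : Y -> Y, injective phi &
    forall y, g x (phi y) (+) g x' (phi y) = ~~ (g x y (+) g x' y).

Lemma sum_sign_mul (gP : decorrelated) (x x' : X) :
  \sum_y (-1) ^+ g x y * (-1) ^+ g x' y = #|Y|%:R * (x == x')%:R :> R.
Proof.
have [<-|/gP[phi phi_inj phiE]] := eqVneq x x'.
  under eq_bigr do rewrite -signr_addb addbb expr0.
  by rewrite sumr_const mulr1.
have : \sum_y (-1) ^+ g x y * (-1) ^+ g x' y =
       - \sum_y (-1) ^+ g x y * (-1) ^+ g x' y :> R.
  rewrite [LHS](reindex_inj phi_inj) -sumrN; apply: eq_bigr => y _.
  by rewrite -!signr_addb phiE signrN.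
by move=> ?; rewrite mulr0; lra.
Qed.

(* Lindsey's lemma. Instead of Cauchy-Schwarz, AM-GM with a free parameter is
   applied to each column, so that no square root occurs. *)
Lemma lindsey (gP : decorrelated) (lam : R) (u : X -> R) (v : Y -> R) :
    0 < lam -> #|X|%:R <= lam ^+ 2 ->
    (forall x, `|u x| <= 1) -> (forall y, `|v y| <= 1) ->
  `|\sum_x \sum_y u x * v y * (-1) ^+ g x y| <= lam * #|Y|%:R.
Proof.
move=> lam0 Xlam u1 v1.
pose z y := \sum_x u x * (-1) ^+ g x y.
have z2 : \sum_y z y ^+ 2 <= lam ^+ 2 * #|Y|%:R.
  have -> : \sum_y z y ^+ 2 = #|Y|%:R * \sum_x u x ^+ 2.
    transitivity (\sum_x \sum_x' u x * u x' *
        \sum_y (-1) ^+ g x y * (-1) ^+ g x' y).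
      under eq_bigr => y _.
        rewrite expr2 /z big_distrl; under eq_bigr do rewrite big_distrr; over.
      rewrite exchange_big; apply: eq_bigr => x _.
      rewrite exchange_big; apply: eq_bigr => x' _.
      by rewrite big_distrr; apply: eq_bigr => y _ /=; sign_ring.
    rewrite big_distrr; apply: eq_bigr => x _ /=.
    rewrite (bigD1 x) //= sum_sign_mul // eqxx big1 ?addr0 /=; first by ring.
    by move=> x' xx'; rewrite sum_sign_mul // eq_sym (negbTE xx') !mulr0.
  rewrite mulrC ler_wpM2r //; apply: le_trans Xlam.
  rewrite -sumr_const; apply: ler_sum => x _.
  by rewrite -real_normK ?num_real // expr_le1.
have -> : \sum_x \sum_y u x * v y * (-1) ^+ g x y = \sum_y v y * z y.
  rewrite exchange_big; apply: eq_bigr => y _.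
  by rewrite big_distrr; apply: eq_bigr => x _ /=; sign_ring.
apply: le_trans (ler_norm_sum _ _ _) _.
apply: (@le_trans _ _ (\sum_y (lam / 2 + z y ^+ 2 / (2 * lam)))).
  apply: ler_sum => y _.
  apply: (@le_trans _ _ `|z y|); first by rewrite normrM ler_piMl.
  rewrite -subr_ge0 -[z y ^+ 2]real_normK ?num_real //.
  have -> : lam / 2 + `|z y| ^+ 2 / (2 * lam) - `|z y| =
            (lam - `|z y|) ^+ 2 / (2 * lam) by field; rewrite gt_eqF.
  by rewrite divr_ge0 ?sqr_ge0 // mulr_ge0 // ltW.
rewrite big_split sumr_const /= -mulr_suml -[_ *+ _]mulr_natr.
have : (\sum_y z y ^+ 2) / (2 * lam) <= lam * #|Y|%:R / 2.
  rewrite ler_pdivrMr ?mulr_gt0 //.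
  by apply: le_trans z2 _; rewrite le_eqVlt; apply/orP; left; apply/eqP; field.
by lra.
Qed.

Variables (X0 Y0 : Type) (a : X -> X0) (b : Y -> Y0).

(* A protocol of cost [D] splits the inputs into [2 ^ D] rectangles. The
   indicator restricts a possibly unbounded tree to its leaves of depth at
   most [D]. *)
Lemma tree_correlation (B : R) (w : party) (t : dprotocol X0 Y0 bool w)
    (D : nat) (u : X -> R) (v : Y -> R) :
    (forall u' v', (forall x, `|u' x| <= 1) -> (forall y, `|v' y| <= 1) ->
      `|\sum_x \sum_y u' x * v' y * (-1) ^+ g x y| <= B) ->
    (forall x, `|u x| <= 1) -> (forall y, `|v y| <= 1) ->
  `|\sum_x \sum_y u x * v y * (-1) ^+ g x y *
      ((-1) ^+ output t (a x) (b y) * (bits t (a x) (b y) <= D)%N%:R)|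
    <= 2 ^+ D * B.
Proof.
move=> HB.
have B0 : 0 <= B.
  apply: le_trans (HB (fun=> 0) (fun=> 0) _ _) => // ?; by rewrite normr0.
have sgn1 (c : bool) : `|(-1) ^+ c : R| = 1 by rewrite normrX normrN1 expr1n.
have b1 (c : bool) : `|c%:R : R| <= 1 by case: c; rewrite ?normr0 ?normr1.
elim: t D u v => [h|p q next IH] D u v u1 v1.
  apply: (@le_trans _ _ B); last by rewrite ler_peMl // exprn_ege1 // ler1n.
  (* The answer at a leaf depends on one input only, so its sign is absorbed into the weight of that
     party. *)
  case: w h => h /=.
    rewrite (eq_bigr (fun x => \sum_y u x * (-1) ^+ h (a x) * v y *
                                 (-1) ^+ g x y)).
      by apply: HB => // x; rewrite normrM sgn1 mulr1.
    by move=> x _; apply: eq_bigr => y _; sign_ring.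
  rewrite (eq_bigr (fun x => \sum_y u x * (v y * (-1) ^+ h (b y)) *
                               (-1) ^+ g x y)).
    by apply: HB => // y; rewrite normrM sgn1 mulr1.
  by move=> x _; apply: eq_bigr => y _; sign_ring.
case: D => [|D] /=.
  rewrite big1 ?normr0 ?mulr_ge0 // => x _.
  by rewrite big1 // => y _; rewrite !mulr0.
pose S c (u' : X -> R) (v' : Y -> R) : R := \sum_x \sum_y u' x * v' y * (-1) ^+ g x y *
      ((-1) ^+ output (next c) (a x) (b y) *
         (bits (next c) (a x) (b y) <= D)%N%:R).
have bound (u' : bool -> X -> R) (v' : bool -> Y -> R) :
    (forall c x, `|u' c x| <= 1) -> (forall c y, `|v' c y| <= 1) ->
    `|S true (u' true) (v' true) + S false (u' false) (v' false)|
       <= 2 ^+ D.+1 * B.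
  move=> u1' v1'; apply: le_trans (ler_normD _ _) _.
  have := IH true D _ _ (u1' true) (v1' true).
  have := IH false D _ _ (u1' false) (v1' false).
  by rewrite exprS /S; lra.
have mul1 (c : R) (d : bool) : `|c| <= 1 -> `|c * d%:R| <= 1.
  by move=> c1; rewrite normrM mulr_ile1.
(* The bit sent cuts only the weight of its sender, so both subtrees again have product weights, now
   with depth budget [D]. *)
case: p q => q.
- have := bound (fun c x => u x * (q (a x) == c)%:R) (fun=> v).
  move=> /(_ (fun c x => mul1 _ _ (u1 x)) (fun=> v1)).
  rewrite /S -big_split /=; congr (`| _ | <= _); apply: eq_bigr => x _.
  rewrite -big_split /=; apply: eq_bigr => y _.
  by rewrite ltnS; case: (q (a x)) => /=; sign_ring.
- have := bound (fun=> u) (fun c y => v y * (q (b y) == c)%:R).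
  move=> /(_ (fun=> u1) (fun c y => mul1 _ _ (v1 y))).
  rewrite /S -big_split /=; congr (`| _ | <= _); apply: eq_bigr => x _.
  rewrite -big_split /=; apply: eq_bigr => y _.
  by rewrite ltnS; case: (q (b y)) => /=; sign_ring.
Qed.

End Rectangles.

(** * Expected cost *)

Section Cost.
Variables (R : realType) (X Y : finType) (X0 Y0 : Type).
Variables (G : X0 -> Y0 -> bool) (a : X -> X0) (b : Y -> Y0).
Hypothesis GP : decorrelated (fun x y => G (a x) (b y)).
Variables (D : nat) (delta : R).
Hypotheses (delta0 : 0 < delta) (XD : 4 ^+ D <= delta ^+ 2 * #|X|%:R).

(** For each input, 1 is at most the summand plus the truncated correlation term: a wrong answer
    within depth [D] costs 2, and a deeper leaf pays at least 1 through its bits. The correlation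
    terms sum to at most [delta] times the number of inputs. *)
Lemma tree_tradeoff (w : party) (t : dprotocol X0 Y0 bool w) :
  #|{: X * Y}|%:R * (1 - delta) <=
  \sum_(z : X * Y) (2 * (output t (a z.1) (b z.2) != G (a z.1) (b z.2))%:R
                    + D.+1%:R^-1 * (bits t (a z.1) (b z.2))%:R).
Proof.
have X0' : 0 < #|X|%:R :> R.
  have := lt_le_trans (exprn_gt0 D (ltr0n R 4)) XD.
  by rewrite pmulr_rgt0 // exprn_gt0.
have D20 : 0 < 2 ^+ D :> R by rewrite exprn_gt0.
(* Chosen so that [2 ^+ D * (lam * #|Y|%:R)] is [delta] times the number of inputs; [XD] then gives
   the condition of [lindsey]. *)
pose lam := delta * #|X|%:R / 2 ^+ D.
have lam0 : 0 < lam by rewrite divr_gt0 ?mulr_gt0.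
have Xlam : #|X|%:R <= lam ^+ 2.
  rewrite /lam expr_div_n ler_pdivlMr ?exprn_gt0 // -exprM mulnC exprM.
  rewrite expr2 -natrM /= exprMn [X in _ <= _ * X]expr2 mulrA mulrC.
  by rewrite ler_wpM2r // ltW.
have := @tree_correlation R X Y _ _ _ a b (lam * #|Y|%:R) w t D (fun=> 1)
  (fun=> 1) (fun u v => lindsey GP lam0 Xlam).
rewrite normr1 => /(_ (fun=> lexx _) (fun=> lexx _)).
move=> /(le_trans (ler_norm _)).
rewrite (_ : 2 ^+ D * _ = #|{: X * Y}|%:R * delta); last first.
  by rewrite card_prod natrM /lam; field; rewrite gt_eqF.
rewrite pair_big /= => corr; rewrite mulrBr mulr1 lerBlDr.
apply: le_trans (lerD (lexx _) corr).
rewrite -big_split /= -sumr_const; apply: ler_sum => -[x y] _ /=.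
move: (bits _ _ _) => m; set e := _ * m%:R.
have e0 : 0 <= e by rewrite mulr_ge0 ?invr_ge0.
have eD : (D < m)%N -> 1 <= e.
  by move=> Dm; rewrite /e mulrC ler_pdivlMr ?mul1r ?ler_nat.
case: (output _ _ _); case: (G _ _); case: leqP => [_|/eD {}eD];
  by rewrite ?expr0 ?expr1 ?mulr0n ?mulr1n; clearbody e; lra.
Qed.

Lemma measurable_nat_preimages d (T : measurableType d) (f : T -> nat) :
  (forall m, measurable [set r | f r = m]%classic) ->
  measurable_fun setT (fun r => (f r)%:R%:E : \bar R).
Proof.
move=> mf; apply/measurable_EFinP.
apply: (@measurableT_comp _ _ _ _ _ _ (fun m : nat => m%:R : R)) => //.
move=> _ A _; rewrite setTI.
rewrite (_ : _ @^-1` A = \bigcup_(m in A) [set r | f r = m])%classic.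
  by apply: bigcup_measurable.
by apply/seteqP; split => [r Ar|r [m Am /= ->//]]; exists (f r).
Qed.

(** The easy half of Yao's principle: [tree_tradeoff] is integrated over the coins, and each input
    has error at most [eps] and cost at most the supremum. The point [y0] makes the number of inputs
    positive. *)
Lemma rand_cc_ge (eps : R) (y0 : Y) : delta <= 1 ->
  ((D.+1%:R * (1 - delta - 2 * eps))%:E <= rand_cc eps G)%E.
Proof.
move=> delta1; apply/ereal_infP => _ [pi [comp ->]].
pose wrong (z : X * Y) := (~` [set r : coin pi |
  output (run r) (a z.1) (b z.2) = G (a z.1) (b z.2)])%classic.
have mwrong z : measurable (wrong z).
  by apply: measurableC; apply: measurable_output.
pose cost (z : X * Y) (r : coin pi) : \bar R :=
  ((bits (run r) (a z.1) (b z.2))%:R)%:E.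
have mcost z : measurable_fun setT (cost z).
  by apply: measurable_nat_preimages => m; apply: measurable_bits.
have wrongE z r : ((output (run r) (a z.1) (b z.2) != G (a z.1) (b z.2))%:R)%:E
    = (\1_(wrong z) r)%:E :> \bar R.
  rewrite indicE; congr (_%:R%:E); congr nat_of_bool.
  by apply/idP/idP => [/eqP /mem_set|/set_mem /eqP].
have inv0 : 0 <= D.+1%:R^-1 :> R by rewrite invr_ge0.
have X0' : 0 < #|{: X * Y}|%:R :> R.
  have := lt_le_trans (exprn_gt0 D (ltr0n R 4)) XD.
  rewrite pmulr_rgt0 ?exprn_gt0 // => X0'; rewrite card_prod natrM mulr_gt0 //.
  by rewrite ltr0n; apply/card_gt0P; exists y0.
have le1 : ((#|{: X * Y}|%:R * (1 - delta))%:E <=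
    \sum_(z : X * Y) (2%:E * coin_law pi (wrong z) + (D.+1%:R^-1)%:E *
       \int[coin_law pi]_r cost z r))%E.
  rewrite -[X in (X <= _)%E]mule1 -(probability_setT (coin_law pi)).
  rewrite -integral_cst //.
  have m1 z : measurable_fun setT
      (fun r => 2%:E * (\1_(wrong z) r)%:E : \bar R)%E.
    apply: emeasurable_funM => //.
    by apply/measurable_EFinP; apply: measurable_indic.
  have m2 z : measurable_fun setT (fun r => (D.+1%:R^-1)%:E * cost z r)%E.
    by apply: emeasurable_funM.
  rewrite (eq_bigr (fun z => \int[coin_law pi]_r
      (2%:E * (\1_(wrong z) r)%:E + (D.+1%:R^-1)%:E * cost z r)))%E; last first.
    move=> z _; rewrite ge0_integralD //; last first.
      by move=> r _; rewrite /cost -EFinM lee_fin mulr_ge0.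
    rewrite !ge0_integralZl //.
    - by rewrite integral_indic ?setIT.
    - by move=> r _; rewrite lee_fin.
    by apply/measurable_EFinP; apply: measurable_indic.
  rewrite -ge0_integral_sum //; last 2 first.
  - by move=> z; apply: emeasurable_funD.
  - by move=> z r _; rewrite /cost -!EFinM -EFinD lee_fin addr_ge0 ?mulr_ge0.
  apply: ge0_le_integral => //.
  - by move=> r _; rewrite lee_fin mulr_ge0 // subr_ge0.
  - by apply: emeasurable_sum => z; apply: emeasurable_funD.
  move=> r _ /=; under eq_bigr do rewrite -wrongE /cost -!EFinM -EFinD.
  by rewrite sumEFin lee_fin; apply: tree_tradeoff.
have leC z : (\int[coin_law pi]_r cost z r <= expected_cost pi)%E.
  by apply: ereal_sup_ubound; exists (a z.1, b z.2).
have leE z : (coin_law pi (wrong z) <= eps%:E)%E.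
  rewrite probability_setC; last exact: measurable_output.
  have := comp (a z.1) (b z.2).
  set p := coin_law pi _; have : p \is a fin_num by apply: fin_num_measure; exact: measurable_output.
  move: p => [p| |] // _; rewrite -EFinB !lee_fin; lra.
case: (expected_cost pi) leC => [C| |] leC; last 2 first.
- by rewrite leey.
- have /card_gt0P[z _] : (0 < #|{: X * Y}|)%N by rewrite -(ltr0n R).
  have : (0 <= \int[coin_law pi]_r cost z r)%E.
    by apply: integral_ge0 => r _; rewrite lee_fin.
  by move=> /le_trans /(_ (leC z)).
have : ((#|{: X * Y}|%:R * (1 - delta))%:E <=
    \sum_(z : X * Y) (2 * eps + D.+1%:R^-1 * C)%:E)%E.
  apply: le_trans le1 _; apply: lee_sum => z _; rewrite [leRHS]EFinD !EFinM.
  by apply: leeD; apply: lee_wpmul2l.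
rewrite sumEFin !lee_fin sumr_const -[X in _ <= X]mulr_natl ler_pM2l // => le2.
have : 1 - delta - 2 * eps <= D.+1%:R^-1 * C by rewrite lerBlDl.
by rewrite [_^-1 * _]mulrC ler_pdivlMr // [_ * D.+1%:R]mulrC.
Qed.

End Cost.

(** * Pointer chasing instances *)

Section Walks.
Variables (T : Type) (na nb : T -> T).

Lemma walkA_iter (K r : nat) (t : T) :
  walkA na nb (K.*2 + r) t = walkA na nb r (iter K (nb \o na) t).
Proof. by elim: K t => //= K IH t; rewrite IH -iterSr. Qed.

Lemma walk_fixed (t : T) (r : nat) : na t = t -> nb t = t ->
  walkA na nb r t = t /\ walkB na nb r t = t.
Proof. by move=> nat_ nbt; elim: r => //= r [IHA IHB]; rewrite nat_ nbt. Qed.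

End Walks.

Section Transport.
Variables (T V : finType) (e : T -> V) (e_inj : injective e).

(* Outside the range of [e] the value does not matter: the identity is used. *)
Definition transport (h : T -> T) : {ffun V -> V} :=
  [ffun v => if [pick t | e t == v] is Some t then e (h t) else v].

Lemma transportE (h : T -> T) (t : T) : transport h (e t) = e (h t).
Proof.
rewrite ffunE; case: pickP => [t' /eqP /e_inj -> //|/(_ t)].
by rewrite eqxx.
Qed.

Lemma walk_transport (na nb : T -> T) (r : nat) (t : T) :
  walkA (transport na) (transport nb) r (e t) = e (walkA na nb r t) /\
  walkB (transport na) (transport nb) r (e t) = e (walkB na nb r t).
Proof.
elim: r t => //= r IH t; rewrite !transportE.
by split; [have [_ ->] := IH (na t) | have [-> _] := IH (nb t)].
Qed.

End Transport.

(** Any injection is corrected one value at a time by a transposition of [V], which leaves the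
    values already prescribed in place. *)
Lemma injection_prescribed (T V : finType) (s : seq T) (w : T -> V) :
    (#|T| <= #|V|)%N -> {in s &, injective w} ->
  exists2 e : T -> V, injective e & {in s, e =1 w}.
Proof.
move=> TV; elim: s => [|t s IH] w_inj.
  exists (fun t => enum_val (widen_ord TV (enum_rank t))) => //.
  by move=> t t' /enum_val_inj /(congr1 val) /= /ord_inj /enum_rank_inj.
have [|e e_inj ew] := IH.
  by move=> t1 t2 s1 s2; apply: w_inj; rewrite inE ?s1 ?s2 orbT.
have [ts|ts] := boolP (t \in s).
  by exists e => // t'; rewrite inE => /predU1P[->|]; apply: ew.
exists (fun t' => tperm (e t) (w t) (e t')).
  by move=> t1 t2 /perm_inj /e_inj.
move=> t'; rewrite inE => /predU1P[->|s']; first by rewrite tpermL.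
have tt' : t != t' by apply: contraNneq ts => ->.
rewrite -(ew _ s') tpermD //; first by rewrite (inj_eq e_inj).
rewrite ew //; apply: contra tt' => /eqP /w_inj -> //;
  by rewrite inE ?eqxx ?s' ?orbT.
Qed.

(* The exclusive or of [K.+1] index functions as a pointer chasing problem.
   A node is either [inl (l, c, i)], where [l] is the current copy, [c] the
   exclusive or of the previous copies and [i] an address, or a terminal
   [inr c], which both parties fix. Alice reads [c] at layer [l] and fills in
   her address [x l]; Bob adds the bit stored there and moves to the next
   layer. *)
Section XorIndex.
Variables (K m : nat).

Definition xor_index (x : {ffun 'I_K.+1 -> 'I_m.+1})
    (y : {ffun 'I_K.+1 * 'I_m.+1 -> bool}) : bool :=
  \big[addb/false]_l y (l, x l).

(** Flip the one bit that [x] reads in a copy where [x] and [x'] differ; [x'] never reads it. *)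
Lemma xor_index_decorrelated : decorrelated xor_index.
Proof.
move=> x x' xx'.
have [l0 xl0] : exists l, x l != x' l.
  apply/existsP; apply: contraNT xx'; rewrite negb_exists => /forallP xx'.
  by apply/eqP/ffunP => l; apply/eqP; have := xx' l; rewrite negbK.
exists (fun y : {ffun 'I_K.+1 * 'I_m.+1 -> bool} =>
    [ffun z => y z (+) (z == (l0, x l0))]).
  apply: inv_inj => y; apply/ffunP => z; rewrite !ffunE.
  by rewrite -addbA addbb addbF.
move=> y; rewrite /xor_index.
under eq_bigr do rewrite ffunE.
under [X in _ (+) X]eq_bigr do rewrite ffunE.
rewrite !big_split /=.
have -> : \big[addb/false]_l ((l, x l) == (l0, x l0)) = true.
  rewrite (bigD1 l0) //= eqxx big1 // => l ll0.
  by rewrite xpair_eqE (negbTE ll0).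
have -> : \big[addb/false]_l ((l, x' l) == (l0, x l0)) = false.
  rewrite big1 // => l _; rewrite xpair_eqE; case: eqP => //= ->.
  by rewrite eq_sym (negbTE xl0).
by rewrite addbF addbT addNb.
Qed.

Definition node := ('I_K.+1 * bool * 'I_m.+1 + bool)%type.

Definition source : node := inl (ord0, false, ord0).

Definition alice (x : {ffun 'I_K.+1 -> 'I_m.+1}) (t : node) : node :=
  match t with
  | inl (l, c, _) => inl (l, c, x l)
  | inr c => inr c
  end.

Definition bob (y : {ffun 'I_K.+1 * 'I_m.+1 -> bool}) (t : node) : node :=
  match t with
  | inl (l, c, i) =>
      if (l < K)%N then inl (inord l.+1, c (+) y (l, i), ord0)
      else inr (c (+) y (l, i))
  | inr c => inr c
  end.

Lemma iter_alice_bob x y :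
  iter K.+1 (bob y \o alice x) source = inr (xor_index x y).
Proof.
pose F l := y (inord l, x (inord l)).
(* The invariant stops at [K], because the last round leads to a terminal instead of a next
   layer. *)
have iterE j : (j <= K)%N -> iter j (bob y \o alice x) source =
    inl (inord j, \big[addb/false]_(0 <= l < j) F l, ord0).
  elim: j => [|j IH] jK.
    by rewrite big_geq //= /source; congr (inl (_, _, _)); apply/val_inj;
       rewrite /= inordK.
  rewrite iterS IH ?(ltnW jK) //= inordK ?(ltnS, ltnW jK) // jK.
  by rewrite big_nat_recr.
rewrite iterS iterE //= inordK // ltnn -/(F K) -(big_nat_recr K 0) //=.
by rewrite big_mkord; congr inr; apply: eq_bigr => l _; rewrite /F inord_val.
Qed.

(** The walk reaches the terminal after [K.+1.*2] steps and spends the remaining ones there. *)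
Lemma pointer_chasing_xor_index (n k : nat) (f : 'I_n.+1 -> bool)
    (e : node -> 'I_n.+1) (x : {ffun 'I_K.+1 -> 'I_m.+1}) y :
    injective e -> e source = ord0 -> (forall c, f (e (inr c)) = c) ->
    (K.+1.*2 <= k)%N ->
  pointer_chasing k f (transport e (alice x)) (transport e (bob y)) =
  xor_index x y.
Proof.
move=> e_inj es fe Kk; rewrite /pointer_chasing -es.
have [-> _] := walk_transport e_inj (alice x) (bob y) k source.
rewrite -(subnKC Kk) walkA_iter iter_alice_bob.
by have [-> _] := @walk_fixed _ (alice x) (bob y) (inr (xor_index x y))
  (k - K.+1.*2) erefl erefl.
Qed.

End XorIndex.

(** * Lower bounds by embedding decorrelated functions *)

Section LowerBounds.
Variables (R : realType) (n k : nat) (f : 'I_n.+1 -> bool) (eps : R).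
Hypothesis fP : nontrivial f.

(** The terminals must avoid [ord0], where the walk starts. *)
Lemma nontrivial_terminals : exists2 term : bool -> 'I_n.+1,
  forall c, term c != ord0 & forall c, f (term c) = c.
Proof.
have [i [j [/eqP i0 /eqP j0 fij]]] := fP.
exists (fun c => if f i == c then i else j) => [c|c].
  by case: ifP.
by case: eqP => // fi; move: fij fi; case: (f i); case: (f j); case: c.
Qed.

(** Alice has [4 ^ (p * K.+1)] inputs, so depth [p * K.+1 - 1] and [delta = 1 / 2] meet the
    condition of [rand_cc_ge] with equality. The last hypothesis makes room for all nodes. *)
Lemma rand_cc_xor_index (K m p : nat) :
    (K.+1.*2 <= k)%N -> m.+1 = (4 ^ p)%N -> (0 < p)%N ->
    (K.+1 * 2 * m.+1 + 2 <= n.+1)%N ->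
  (((p * K.+1)%:R * (1 / 2 - 2 * eps))%:E
    <= rand_cc eps (pointer_chasing k f))%E.
Proof.
move=> Kk mp p0 card_le.
have [term term0 fterm] := nontrivial_terminals.
pose w (t : node K m) := if t is inr c then term c else ord0.
have [||e e_inj ew] := @injection_prescribed (node K m) 'I_n.+1
    [:: source K m; inr true; inr false] w.
- by rewrite card_sum !card_prod !card_ord card_bool.
- move=> t t'; rewrite !inE.
  have term_inj : injective term by apply: can_inj fterm.
  have t0 c : (ord0 == term c) = false by rewrite eq_sym (negbTE (term0 _)).
  by move=> /or3P[] /eqP -> /or3P[] /eqP -> //= /eqP;
    rewrite ?t0 ?[_ == ord0]eq_sym ?t0 ?(inj_eq term_inj).
have es : e (source K m) = ord0 by rewrite ew // !inE eqxx.
have fe c : f (e (inr c)) = c by rewrite ew ?fterm // !inE; case: c.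
have pcE x y := pointer_chasing_xor_index x y e_inj es fe Kk.
have dec : decorrelated (fun x y =>
    pointer_chasing k f (transport e (alice x)) (transport e (bob y))).
  move=> x x' /xor_index_decorrelated[phi phi_inj phiE].
  by exists phi => // y; rewrite !pcE.
have pK : (0 < p * K.+1)%N by rewrite muln_gt0 p0.
have := @rand_cc_ge R _ _ _ _ _ _ _ dec (p * K.+1).-1 (1 / 2) _ _ eps
  [ffun=> false] _.
rewrite prednK // (_ : 1 - 1 / 2 - 2 * eps = 1 / 2 - 2 * eps); last by lra.
apply; [lra| |lra].
rewrite card_ffun !card_ord mp -expnM natrX.
case: (p * K.+1)%N pK => //= P _; rewrite expr2 exprS.
by move: (4 ^+ P) => q; lra.
Qed.

(* With the address restricted to one bit and Bob either fixing all nodes or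
   sending all of them to the terminal for [false], the value is the
   conjunction, whose sign matrix is the Hadamard matrix of order 2. *)
Lemma rand_cc_and : (2 <= k)%N ->
  ((1 / 4 - 2 * eps)%:E <= rand_cc eps (pointer_chasing k f))%E.
Proof.
move=> k2.
have [term term0 fterm] := nontrivial_terminals.
pose a (x : bool) : {ffun 'I_n.+1 -> 'I_n.+1} :=
  [ffun v => if v == ord0 then term x else v].
pose b (y : bool) : {ffun 'I_n.+1 -> 'I_n.+1} :=
  [ffun v => if y then v else term false].
have pcE x y : pointer_chasing k f (a x) (b y) = x && y.
  rewrite /pointer_chasing -(subnKC k2) -[2%N]/(1.*2) walkA_iter /=.
  have -> : b y (a x ord0) = term (x && y).
    by rewrite !ffunE eqxx; case: y; rewrite ?andbT ?andbF.
  have [||-> _] := @walk_fixed _ (a x) (b y) (term (x && y)) (k - 2).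
  - by rewrite ffunE (negbTE (term0 _)).
  - by rewrite ffunE; case: y; rewrite ?andbF.
  by rewrite fterm.
have dec : decorrelated (fun x y => pointer_chasing k f (a x) (b y)).
  move=> x x' xx'; exists negb; first exact: negb_inj.
  by move: x x' xx' => [] [] // _ [] /=; rewrite !pcE.
(* Depth 0 with two rows requires [1 <= 2 * delta ^+ 2], which [3 / 4] satisfies. *)
have := @rand_cc_ge R _ _ _ _ _ _ _ dec 0 (3 / 4) _ _ eps true _.
rewrite (_ : _ * (1 - 3 / 4 - 2 * eps) = 1 / 4 - 2 * eps); last by lra.
by apply; rewrite ?card_bool ?expr0 ?expr2; lra.
Qed.

End LowerBounds.

(** * The trade-off between the number and the size of the index functions *)

Lemma ln_le_sub1 (R : realType) (x : R) : 0 < x -> ln x <= x - 1.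
Proof. by move=> x0; rewrite -{1}[x](subrKC 1) le_ln1Dx // ltrBrDl subrr. Qed.

Lemma ln_le_exponent (R : realType) (x : R) (j : nat) :
  0 < x -> x <= 2 ^+ j -> ln x <= j%:R.
Proof.
move=> x0 xj; apply: (@le_trans _ _ (ln (2 ^+ j))).
  by rewrite ler_ln ?posrE ?exprn_gt0.
rewrite lnXn // -[ln 2 *+ j]mulr_natr ler_piMl //.
by apply: le_trans (ln_le_sub1 _) _ => //; lra.
Qed.

(** The bound starts at [k = 2]: for [k = 1] Alice can answer without communication. *)
Theorem theorem3 (R : realType) :
  exists eps c : R,
    [/\ 0 < eps < 1,
        0 < c &
        forall (n k : nat) (f : 'I_n.+1 -> bool),
          (2 <= k)%N -> (k <= n.+1)%N -> nontrivial f ->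
          ((c * (k%:R * ln (n.+1%:R / k%:R)))%:E
             <= rand_cc eps (pointer_chasing k f))%E].
Proof.
(* This error leaves factors [3 / 8] and [1 / 8] in the two lower bounds; [1 / 128] is [1 / 8] over
   16 and [3 / 8] over 48. *)
exists (1 / 16), (1 / 128); split; [lra|lra|move=> n k f k2 kn fP].
have k0 : 0 < k%:R :> R by rewrite ltr0n; lia.
have nk0 : 0 < n.+1%:R / k%:R :> R by rewrite divr_gt0.
have [nk|kn8] := ltnP n.+1 (8 * k).
  (* Here a cost linear in [n.+1] suffices. *)
  have lnn : k%:R * ln (n.+1%:R / k%:R) <= n.+1%:R :> R.
    apply: (@le_trans _ _ (k%:R * (n.+1%:R / k%:R))).
      rewrite ler_pM2l //; apply: le_trans (ln_le_sub1 nk0) _.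
      by rewrite gerBl.
    by rewrite mulrC divfK ?gt_eqF.
  have [n16|n16] := ltnP n.+1 16.
    apply: le_trans (rand_cc_and _ fP k2); rewrite lee_fin.
    have : n.+1%:R <= 16 :> R by rewrite ler_nat ltnW.
    by lra.
  have [K1 K2 K3 K4] : [/\ (n.+1 %/ 16).-1.+1 = n.+1 %/ 16,
      (n.+1 %/ 16).*2 <= k, n.+1 %/ 16 * 2 * 4 + 2 <= n.+1 &
      n.+1 <= 48 * (n.+1 %/ 16)]%N by split; lia.
  apply: le_trans (@rand_cc_xor_index R n k f _ fP (n.+1 %/ 16).-1 3 1 _ _ _ _);
    rewrite ?K1 // mul1n lee_fin.
  have : n.+1%:R <= 48 * (n.+1 %/ 16)%:R :> R by rewrite -natrM ler_nat.
  by move: (_ %/ 16)%:R => N; lra.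
(* With [k./2] copies of [4 ^ p] addresses the layers take at most half of the nodes, which leaves
   room for the terminals. *)
pose p := trunc_log 4 (n.+1 %/ (2 * k)).
have d4 : (4 <= n.+1 %/ (2 * k))%N by rewrite leq_divRL; lia.
have p0 : (0 < p)%N by rewrite trunc_log_gt0.
have /andP[p1 p2] : (4 ^ p <= n.+1 %/ (2 * k) < 4 ^ p.+1)%N.
  by apply: trunc_log_bounds => //; lia.
have q0 : (4 ^ p).-1.+1 = (4 ^ p)%N by rewrite prednK ?expn_gt0.
have [K1 K2 K3] : [/\ k./2.-1.+1 = k./2, k./2.*2 <= k & k <= 3 * k./2]%N.
  by split; lia.
have q1 : (k * (2 * 4 ^ p) <= n.+1)%N.
  by move: p1; rewrite leq_divRL; lia.
apply: le_trans (@rand_cc_xor_index R n k f _ fP k./2.-1 (4 ^ p).-1 p _ _ _ _);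
  rewrite ?q0 ?K1 //.
  rewrite lee_fin.
  (* Maximality of [p] bounds the quotient by [2 * 4 ^ p.+1], that is, [2 ^ (2 * p + 3)]. *)
  have lnp : ln (n.+1%:R / k%:R) <= (2 * p + 3)%:R :> R.
    apply: ln_le_exponent => //; rewrite ler_pdivrMr // -natrX -natrM ler_nat.
    rewrite expnD expnM -[(2 ^ 2)%N]/4%N -[(2 ^ 3)%N]/8%N.
    by move: p2; rewrite ltn_divLR ?expnS; lia.
  have /(ler_wpM2l (ltW k0)) : ln (n.+1%:R / k%:R) <= (5 * p)%:R :> R.
    by apply: le_trans lnp _; rewrite ler_nat; lia.
  have : (k * (5 * p))%:R <= (15 * (p * k./2))%:R :> R by rewrite ler_nat; nia.
  have : 0 <= (p * k./2)%:R :> R by [].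
  rewrite !natrM; move: (k%:R * ln _) => L; lra.
by nia.
Qed.
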